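(* Let $p,q$ be nonnegative integers, let $\kappa_1,\dots,\kappa_p,\mu_1,\dots,\mu_q$ be complex numbers none of which is in $\{0,-1,-2,\dots\}$, let $\alpha,\beta\in\mathbb{C}$ with $\Re(\alpha)>0$, let $\lambda_2,\lambda_3\in\mathbb{C}$ with $\Re(\lambda_3)>\Re(\lambda_2)>0$, let $\rho\in\mathbb{C}$ with $\Re(\rho)>0$, and let $z\in\mathbb{C}$. Then the M-confluent hypergeometric function satisfies $${}^{M}\Phi_{p,q}^{(\alpha,\beta)}(\lambda_{2};\lambda_{3};z;\rho)=\exp(z)\;{}^{M}\Phi_{p,q}^{(\alpha,\beta)}(\lambda_{3}-\lambda_{2};\lambda_{3};-z;\rho).$$
   Context: $(\lambda)_m=\Gamma(\lambda+m)/\Gamma(\lambda)$, $(\lambda)_0=1$ is the Pochhammer symbol and $B(x,y)=\int_0^1 t^{x-1}(1-t)^{y-1}dt$ is the classical beta function. The generalized M-series is $${}_{p}^{\alpha}M^{\beta}_{q}(\kappa_{1},\ldots,\kappa_{p};\mu_{1},\ldots,\mu_{q};z)=\sum_{m=0}^{\infty}\frac{(\kappa_{1})_{m}\cdots(\kappa_p)_{m}}{(\mu_1)_{m}\cdots(\mu_q)_{m}}\frac{z^{m}}{\Gamma(\alpha m+\beta)}.$$ With parameters $\kappa_1,\dots,\kappa_p;\mu_1,\dots,\mu_q$ suppressed from the notation, the modified beta (M-beta) and modified confluent hypergeometric (M-confluent hypergeometric) functions are $${}^{M}B_{p,q}^{(\alpha,\beta)}(x,y;\rho)=\int_{0}^{1}t^{x-1}(1-t)^{y-1}\,{}_{p}^{\alpha}M^{\beta}_{q}\left(\kappa_{1},\ldots,\kappa_{p};\mu_{1},\ldots,\mu_{q};\frac{-\rho}{t(1-t)}\right)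 dt,$$ $${}^{M}\Phi_{p,q}^{(\alpha,\beta)}(\lambda_{2};\lambda_{3};z;\rho)=\sum_{n=0}^{\infty}\frac{{}^{M}B_{p,q}^{(\alpha,\beta)}(\lambda_{2}+n,\lambda_{3}-\lambda_{2};\rho)}{B(\lambda_{2},\lambda_{3}-\lambda_{2})}\frac{z^{n}}{n!}.$$ These functions are defined for those parameters and arguments for which the series and integrals converge. *)

(* Defs.v *)
From Stdlib Require Import Reals List ZArith.
From Coquelicot Require Import Coquelicot.

Open Scope C_scope.

Definition Cexp (z : C) : C :=
  (exp (Re z) * cos (Im z), exp (Re z) * sin (Im z))%R.

(* Principal value of t^s, meaningful for t > 0 only. *)
Definition Rcpow (t : R) (s : C) : C := Cexp (s * RtoC (ln t)).

(* Sum of a complex series; meaningful when [Cex_series a] holds. *)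
Definition CSeries (a : nat -> C) : C :=
  (Series (fun n => Re (a n)), Series (fun n => Im (a n))).

Definition Cex_series (a : nat -> C) : Prop :=
  ex_series (V := C_R_NormedModule) a.

(* Integrals over ]0,1[ are improper at both endpoints, so conditional
   convergence is allowed. *)
Definition CInt01 (f : R -> C) : C :=
  RInt_gen (V := C_R_CompleteNormedModule) f (at_right 0) (at_left 1).

Definition Cex_int01 (f : R -> C) : Prop :=
  ex_RInt_gen (V := C_R_NormedModule) f (at_right 0) (at_left 1).

Fixpoint shift_prod (s : C) (n : nat) : C :=
  match n with
  | O => 1
  | S k => shift_prod s k * (s + RtoC (INR k))
  end.

(* Euler's integral, convergent for Re s > 0. *)
Definition Euler_Gamma (s : C) : C :=
  RInt_gen (V := C_R_CompleteNormedModule)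
    (fun t => Rcpow t (s - 1) * RtoC (exp (- t)))
    (at_right 0) (Rbar_locally p_infty).

(* A natural number n with Re s + n > 0. *)
Definition Gamma_shift (s : C) : nat := Z.to_nat (up (- Re s)).

(* Analytic continuation through Gamma(s) = Gamma(s+n) / (s(s+1)...(s+n-1));
   meaningful when s is not in {0,-1,-2,...}. *)
Definition Gamma (s : C) : C :=
  let n := Gamma_shift s in
  Euler_Gamma (s + RtoC (INR n)) / shift_prod s n.

(* The entire function 1/Gamma; it vanishes at the poles of Gamma because
   the product then contains a zero factor. *)
Definition recip_Gamma (s : C) : C :=
  let n := Gamma_shift s in
  shift_prod s n / Euler_Gamma (s + RtoC (INR n)).

Definition pochhammer (a : C) (m : nat) : C :=
  match m with
  | O => 1
  | S _ => Gamma (a + RtoC (INR m)) / Gamma a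
  end.

Definition Beta (x y : C) : C :=
  CInt01 (fun t => Rcpow t (x - 1) * Rcpow (1 - t) (y - 1)).

Definition nonpos_integer (s : C) : Prop :=
  exists k : nat, s = - RtoC (INR k).

Definition pochhammer_prod (l : list C) (m : nat) : C :=
  fold_right Cmult 1 (map (fun a => pochhammer a m) l).

Definition Mseries_term (kappa mu : list C) (alpha beta w : C) (m : nat) : C :=
  pochhammer_prod kappa m / pochhammer_prod mu m
  * (Cpow w m * recip_Gamma (alpha * RtoC (INR m) + beta)).

Definition Mseries (kappa mu : list C) (alpha beta w : C) : C :=
  CSeries (Mseries_term kappa mu alpha beta w).

Definition Mseries_defined (kappa mu : list C) (alpha beta w : C) : Prop :=
  Cex_series (Mseries_term kappa mu alpha beta w).

Definition Mbeta_arg (rho : C) (t : R) : C := - rho / RtoC (t * (1 - t)).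

Definition Mbeta_integrand (kappa mu : list C) (alpha beta x y rho : C)
    (t : R) : C :=
  Rcpow t (x - 1) * Rcpow (1 - t) (y - 1)
  * Mseries kappa mu alpha beta (Mbeta_arg rho t).

Definition Mbeta (kappa mu : list C) (alpha beta x y rho : C) : C :=
  CInt01 (Mbeta_integrand kappa mu alpha beta x y rho).

Definition Mbeta_defined (kappa mu : list C) (alpha beta x y rho : C) : Prop :=
  (forall t : R, (0 < t < 1)%R ->
     Mseries_defined kappa mu alpha beta (Mbeta_arg rho t)) /\
  Cex_int01 (Mbeta_integrand kappa mu alpha beta x y rho).

Definition MPhi_term (kappa mu : list C) (alpha beta l2 l3 z rho : C)
    (n : nat) : C :=
  Mbeta kappa mu alpha beta (l2 + RtoC (INR n)) (l3 - l2) rho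
  / Beta l2 (l3 - l2)
  * (Cpow z n / RtoC (INR (fact n))).

Definition MPhi (kappa mu : list C) (alpha beta l2 l3 z rho : C) : C :=
  CSeries (MPhi_term kappa mu alpha beta l2 l3 z rho).

(* All series and integrals in the definition of [MPhi] converge. *)
Definition MPhi_defined (kappa mu : list C) (alpha beta l2 l3 z rho : C)
    : Prop :=
  (forall n : nat,
     Mbeta_defined kappa mu alpha beta (l2 + RtoC (INR n)) (l3 - l2) rho) /\
  Cex_series (MPhi_term kappa mu alpha beta l2 l3 z rho).

(* Main.v *)
(** Put [g(t) = t^(l2-1) (1-t)^(l3-l2-1) M(-rho/(t(1-t)))], [a_n = int t^n g] and
    [b_n = int (1-t)^n g]. The argument of [M] is invariant under [t -> 1-t], so
    the two sides of the transformation are the exponential generating functions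
    of [a] at [z] and of [b] at [-z], both divided by the same Beta value.
    Expanding [(1-t)^n] gives [b_n = sum_k C(n,k) (-1)^k a_k]; equivalently, the
    terms [b_n (-z)^n/n!] are the Cauchy product of [a_n z^n/n!] with
    [(-z)^n/n!]. Only convergence of the first series is assumed, so it is
    Mertens' theorem, with the absolute convergence of the exponential series,
    that yields both the convergence and the value of the product. *)

Require Import Defs.
From Stdlib Require Import Reals List Arith Lra Lia FunctionalExtensionality PropExtensionality.
From Coquelicot Require Import Coquelicot.

Open Scope R_scope.

(** * Mertens' theorem for real series *)

Lemma sum_f_R0_rev (f : nat -> R) (n : nat) :
  sum_f_R0 (fun k => f (n - k)%nat) n = sum_f_R0 f n.
Proof.
  induction n as [|n IH]; [reflexivity|].
  rewrite decomp_sum by lia; simpl pred; cbn [Nat.sub].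
  rewrite IH; simpl; ring.
Qed.

(** Serves to bound the tail of a convergent series uniformly in [n]. The [max] covers [n <= N],
    where both sides are 0. *)
Lemma sum_f_R0_truncated (f : nat -> R) (N n : nat) :
  sum_f_R0 (fun j => if Nat.leb j N then 0 else f j) n =
  sum_f_R0 f (max n N) - sum_f_R0 f N.
Proof.
  induction n as [|n IH].
  - simpl; ring.
  - rewrite tech5, IH; destruct (Nat.leb_spec (S n) N) as [H|H].
    + rewrite !Nat.max_r by lia; ring.
    + rewrite !Nat.max_l by lia; simpl; ring.
Qed.

(* For [n >= N1 + N2], each index [k] has either [k >= N1], where [e k] is small,
   or [n - k > N2], where [b (n - k)] lies in the tail of the series. *)
Lemma is_lim_seq_convolution_0 (e b : nat -> R) :
  is_lim_seq e 0 -> ex_series (fun n => Rabs (b n)) ->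
  is_lim_seq (fun n => sum_f_R0 (fun k => e k * b (n - k)%nat) n) 0.
Proof.
  intros He [S HS].
  assert (Hpartial : forall n, sum_f_R0 (fun n => Rabs (b n)) n <= S).
  { intros n; apply sum_incr; [|intros; apply Rabs_pos].
    apply is_lim_seq_Reals; eapply is_lim_seq_ext; [|exact HS].
    intros; apply sum_n_Reals. }
  assert (HS0 : 0 <= S).
  { eapply Rle_trans; [|apply (Hpartial 0%nat)]; apply Rabs_pos. }
  assert (HE : exists E, 0 < E /\ forall k, Rabs (e k) <= E).
  { destruct (filterlim_bounded e) as [E HE].
    - exists 0; exact He.
    - exists (Rmax E 1); split.
      + pose proof (Rmax_r E 1); lra.
      + intros k; eapply Rle_trans; [apply HE|apply Rmax_l]. }
  destruct HE as [E [HE0 HE]].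
  apply is_lim_seq_Reals; intros eps Heps.
  (* The two parts of the bound below contribute at most [d * S] and [E * d]. The extra 1 keeps the
     denominator positive and makes the final inequality strict. *)
  set (d := eps / (S + E + 1)).
  assert (Hd : 0 < d) by (apply Rdiv_lt_0_compat; lra).
  apply is_lim_seq_Reals in He; destruct (He d Hd) as [N1 HN1].
  assert (HW : Un_cv (sum_f_R0 (fun n => Rabs (b n))) S).
  { apply is_lim_seq_Reals; eapply is_lim_seq_ext; [|exact HS].
    intros; apply sum_n_Reals. }
  destruct (HW d Hd) as [N2 HN2].
  exists (N1 + N2)%nat; intros n Hn.
  unfold Rdist; rewrite Rminus_0_r.
  eapply Rle_lt_trans; [apply Rsum_abs|].
  set (tail := fun j => if Nat.leb j N2 then 0 else Rabs (b j)).
  apply Rle_lt_trans with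
    (sum_f_R0 (fun k => d * Rabs (b (n - k)%nat) + E * tail (n - k)%nat) n).
  - apply sum_Rle; intros k Hk; rewrite Rabs_mult.
    assert (0 <= tail (n - k)%nat)
      by (unfold tail; destruct (Nat.leb_spec (n - k) N2);
          [lra|apply Rabs_pos]).
    pose proof (Rabs_pos (b (n - k)%nat)).
    destruct (Nat.leb_spec N1 k) as [Hk1|Hk1].
    + specialize (HN1 k Hk1); unfold Rdist in HN1.
      rewrite Rminus_0_r in HN1.
      apply Rle_trans with (d * Rabs (b (n - k)%nat)).
      * apply Rmult_le_compat_r; lra.
      * pose proof (Rmult_le_pos E (tail (n - k)%nat) (Rlt_le _ _ HE0)); lra.
    + replace (tail (n - k)%nat) with (Rabs (b (n - k)%nat)).
      * pose proof (Rmult_le_compat_r _ _ _ (Rabs_pos (b (n - k)%nat)) (HE k)).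
        pose proof (Rmult_le_pos d (Rabs (b (n - k)%nat)) (Rlt_le _ _ Hd)); lra.
      * unfold tail; destruct (Nat.leb_spec (n - k) N2); [lia|reflexivity].
  - rewrite (sum_f_R0_rev (fun j => d * Rabs (b j) + E * tail j)), sum_plus.
    assert (Hd1 : sum_f_R0 (fun j => d * Rabs (b j)) n <= d * S).
    { rewrite (sum_eq _ (fun j => Rabs (b j) * d)) by (intros; ring).
      rewrite <- scal_sum; apply Rmult_le_compat_l; [lra|apply Hpartial]. }
    assert (Hd2 : sum_f_R0 (fun j => E * tail j) n <= E * d).
    { rewrite (sum_eq _ (fun j => tail j * E)) by (intros; ring).
      rewrite <- scal_sum; apply Rmult_le_compat_l; [lra|].
      (* The truncated sum is a difference of two partial sums: the first is at most [S], the second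
         exceeds [S - d]. *)
      unfold tail; rewrite (sum_f_R0_truncated (fun j => Rabs (b j))).
      pose proof (Hpartial (max n N2)); pose proof (Hpartial N2).
      specialize (HN2 N2 (le_n _)); unfold Rdist in HN2.
      apply Rabs_def2 in HN2; lra. }
    assert (d * (S + E + 1) = eps) by (unfold d; field; lra).
    lra.
Qed.

(** Both sides add [a i * b j] over the triangle [i + j <= n], the left one along antidiagonals, the
    right one grouped by [j = n - k]. *)
Lemma sum_f_R0_cauchy_product (a b : nat -> R) (n : nat) :
  sum_f_R0 (fun m => sum_f_R0 (fun k => a k * b (m - k)%nat) m) n =
  sum_f_R0 (fun k => sum_f_R0 a k * b (n - k)%nat) n.
Proof.
  induction n as [|n IH]; [reflexivity|].
  rewrite tech5, IH.
  rewrite (decomp_sum (fun k => a k * b (S n - k)%nat)) by lia.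
  rewrite (decomp_sum (fun k => sum_f_R0 a k * b (S n - k)%nat)) by lia.
  simpl pred; cbn [Nat.sub].
  rewrite (sum_eq (fun i => sum_f_R0 a (S i) * b (n - i)%nat)
     (fun i => sum_f_R0 a i * b (n - i)%nat + a (S i) * b (n - i)%nat))
    by (intros; simpl; ring).
  rewrite sum_plus; simpl; ring.
Qed.

(** Write the partial sums of [a] as [la + e k] with [e] tending to 0. By [sum_f_R0_cauchy_product]
    the partial sums of the product are [la] times those of [b], plus the convolution of [e] with
    [b], which tends to 0. *)
Lemma is_series_mertens (a b : nat -> R) (la lb : R) :
  is_series a la -> is_series b lb -> ex_series (fun n => Rabs (b n)) ->
  is_series (fun n => sum_f_R0 (fun k => a k * b (n - k)%nat) n) (la * lb).
Proof.
  intros Ha Hb Hb'.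
  change (is_lim_seq (sum_n a) la) in Ha.
  change (is_lim_seq (sum_n b) lb) in Hb.
  match goal with |- is_series ?f _ =>
    change (is_lim_seq (sum_n f) (la * lb)) end.
  assert (He : is_lim_seq (fun k => sum_n a k - la) 0).
  { replace (Finite 0) with (Finite (la - la)) by (f_equal; ring).
    apply is_lim_seq_minus'; [exact Ha|apply is_lim_seq_const]. }
  pose proof (is_lim_seq_convolution_0 _ _ He Hb') as H.
  pose proof (is_lim_seq_plus' _ _ _ _ H
    (is_lim_seq_scal_l _ la _ Hb)) as H1; simpl in H1.
  rewrite Rplus_0_l in H1; eapply is_lim_seq_ext; [|exact H1].
  intros n; cbv beta.
  rewrite !sum_n_Reals, sum_f_R0_cauchy_product.
  rewrite <- (sum_f_R0_rev b n), scal_sum, <- sum_plus.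
  apply sum_eq; intros i _; rewrite sum_n_Reals; ring.
Qed.

Open Scope C_scope.

(** * Complex series by real and imaginary parts; finite sums *)

Lemma Re_sum_n (a : nat -> C) (n : nat) :
  Re (sum_n a n) = sum_n (fun k => Re (a k)) n.
Proof.
  induction n as [|n IH]; [rewrite !sum_O|rewrite !sum_Sn, <- IH]; reflexivity.
Qed.

Lemma Im_sum_n (a : nat -> C) (n : nat) :
  Im (sum_n a n) = sum_n (fun k => Im (a k)) n.
Proof.
  induction n as [|n IH]; [rewrite !sum_O|rewrite !sum_Sn, <- IH]; reflexivity.
Qed.

(** The uniform structure on [C] is that of a product: a ball is a pair of real balls of the same
    radius. This links convergence in [C] to [CSeries], which is defined by components. *)
Lemma is_series_C_components (a : nat -> C) (l : C) :
  is_series (V := C_R_NormedModule) a l <->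
  is_series (fun n => Re (a n)) (Re l) /\ is_series (fun n => Im (a n)) (Im l).
Proof.
  split.
  - intros H; split.
    + apply filterlim_ext with (fun n => Re (sum_n a n)).
      * intros; apply Re_sum_n.
      * eapply filterlim_comp; [exact H|].
        intros P [eps HP]; exists eps; intros y [Hy _]; apply HP, Hy.
    + apply filterlim_ext with (fun n => Im (sum_n a n)).
      * intros; apply Im_sum_n.
      * eapply filterlim_comp; [exact H|].
        intros P [eps HP]; exists eps; intros y [_ Hy]; apply HP, Hy.
  - intros [H1 H2].
    apply (filterlim_locally (U := C_R_NormedModule)); intros eps.
    pose proof (proj1 (filterlim_locally _ _) H1 eps) as E1.
    pose proof (proj1 (filterlim_locally _ _) H2 eps) as E2.
    generalize (filter_and _ _ E1 E2); apply filter_imp.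
    intros n [B1 B2]; rewrite <- Re_sum_n in B1; rewrite <- Im_sum_n in B2.
    split; [exact B1|exact B2].
Qed.

Lemma CSeries_unique (a : nat -> C) (l : C) :
  is_series (V := C_R_NormedModule) a l -> CSeries a = l.
Proof.
  intros H; apply is_series_C_components in H; destruct H as [H1 H2].
  unfold CSeries; rewrite (is_series_unique _ _ H1), (is_series_unique _ _ H2).
  symmetry; apply surjective_pairing.
Qed.

(** Four real Cauchy products, combined as in complex multiplication. The real and imaginary parts
    of [b] converge absolutely because each is bounded by the modulus. *)
Lemma is_series_C_mertens (a b : nat -> C) (la lb : C) :
  is_series (V := C_R_NormedModule) a la ->
  is_series (V := C_R_NormedModule) b lb ->
  ex_series (fun n => Cmod (b n)) ->
  is_series (V := C_R_NormedModule)
    (fun n => sum_n (fun k => a k * b (n - k)%nat) n) (la * lb).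
Proof.
  intros Ha Hb Hb'.
  apply is_series_C_components in Ha; destruct Ha as [Ha1 Ha2].
  apply is_series_C_components in Hb; destruct Hb as [Hb1 Hb2].
  assert (Hb1' : ex_series (fun n => Rabs (Re (b n)))).
  { apply (ex_series_le (V := R_CompleteNormedModule)) with (2 := Hb').
    intros n; unfold norm; simpl; unfold abs; simpl; rewrite Rabs_Rabsolu.
    apply re_le_Cmod. }
  assert (Hb2' : ex_series (fun n => Rabs (Im (b n)))).
  { apply (ex_series_le (V := R_CompleteNormedModule)) with (2 := Hb').
    intros n; unfold norm; simpl; unfold abs; simpl; rewrite Rabs_Rabsolu.
    eapply Rle_trans; [apply Rmax_r|apply Rmax_Cmod]. }
  apply is_series_C_components; split.
  - pose proof (is_series_minus _ _ _ _
      (is_series_mertens _ _ _ _ Ha1 Hb1 Hb1')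
      (is_series_mertens _ _ _ _ Ha2 Hb2 Hb2')) as H.
    eapply is_series_ext; [|exact H].
    intros n; cbv beta; rewrite Re_sum_n, sum_n_Reals; simpl.
    symmetry; apply (minus_sum (fun k => (Re (a k) * Re (b (n - k)%nat))%R)).
  - pose proof (is_series_plus _ _ _ _
      (is_series_mertens _ _ _ _ Ha1 Hb2 Hb2')
      (is_series_mertens _ _ _ _ Ha2 Hb1 Hb1')) as H.
    eapply is_series_ext; [|exact H].
    intros n; cbv beta; rewrite Im_sum_n, sum_n_Reals; simpl.
    symmetry; apply (sum_plus (fun k => (Re (a k) * Im (b (n - k)%nat))%R)).
Qed.

Lemma sum_n_Sn_first {G : AbelianMonoid} (f : nat -> G) (n : nat) :
  sum_n f (S n) = plus (f O) (sum_n (fun k => f (S k)) n).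
Proof.
  unfold sum_n; rewrite sum_Sn_m by lia; f_equal.
  symmetry; apply sum_n_m_S.
Qed.

Lemma sum_n_scal_r {K : Ring} {V : ModuleSpace K} (c : nat -> K) (v : V) (n : nat) :
  sum_n (fun k => scal (c k) v) n = scal (sum_n c n) v.
Proof.
  induction n as [|n IH]; [rewrite !sum_O; reflexivity|].
  rewrite !sum_Sn, IH, scal_distr_r; reflexivity.
Qed.

Lemma Cmult_reg_l (c u v : C) : c * u = c * v -> c <> 0 -> u = v.
Proof.
  intros H Hc; replace u with (/ c * (c * u)) by (field; exact Hc).
  rewrite H; field; exact Hc.
Qed.

(** * The complex exponential and its power series *)

Definition exp_term (z : C) (n : nat) : C := Cpow z n / RtoC (INR (fact n)).

Lemma RtoC_INR_fact_neq_0 (n : nat) : RtoC (INR (fact n)) <> 0.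
Proof. intros H; apply (INR_fact_neq_0 n), RtoC_inj, H. Qed.

Lemma RtoC_INR_S_neq_0 (n : nat) : RtoC (INR (S n)) <> 0.
Proof. intros H; apply (not_0_INR (S n)); [discriminate|apply RtoC_inj, H]. Qed.

Lemma exp_term_S (z : C) (n : nat) :
  RtoC (INR (S n)) * exp_term z (S n) = z * exp_term z n.
Proof.
  unfold exp_term; rewrite Cpow_S.
  change (fact (S n)) with (S n * fact n)%nat.
  rewrite mult_INR, RtoC_mult; field.
  split; [apply RtoC_INR_fact_neq_0|apply RtoC_INR_S_neq_0].
Qed.

(* Multiply by [n + 1 = k + (n + 1 - k)] and absorb each factor with
   [exp_term_S]. *)
Lemma exp_term_plus (u v : C) (n : nat) :
  exp_term (u + v) n =
  sum_n (fun k => exp_term u k * exp_term v (n - k)%nat) n.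
Proof.
  induction n as [|n IH].
  - rewrite sum_O; unfold exp_term; simpl; field.
  - apply (Cmult_reg_l (RtoC (INR (S n)))); [|apply RtoC_INR_S_neq_0].
    rewrite exp_term_S, Cmult_plus_distr_r, IH.
    rewrite <- (sum_n_mult_l (K := C_Ring) (RtoC (INR (S n)))).
    transitivity (plus
      (sum_n (fun k => RtoC (INR k) * (exp_term u k * exp_term v (S n - k)%nat)) (S n))
      (sum_n (fun k => RtoC (INR (S n - k)) * (exp_term u k * exp_term v (S n - k)%nat)) (S n))).
    (* The term [k = 0] of the first sum and the term [k = n + 1] of the second carry the factor 0.
       After an index shift in the first, the remaining sums are the contributions of [u] and
       [v]. *)
    + rewrite sum_n_Sn_first, sum_Sn, Nat.sub_diag.
      rewrite <- !(sum_n_mult_l (K := C_Ring)).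
      replace (RtoC (INR 0) * (exp_term u 0 * exp_term v (S n - 0)%nat))
        with (zero : C) by (cbn [INR]; symmetry; apply Cmult_0_l).
      replace (RtoC (INR 0) * (exp_term u (S n) * exp_term v 0))
        with (zero : C) by (cbn [INR]; symmetry; apply Cmult_0_l).
      rewrite plus_zero_l, plus_zero_r.
      apply (f_equal2 Cplus); apply sum_n_ext_loc; intros k Hk.
      * change (u * (exp_term u k * exp_term v (n - k)%nat) =
          RtoC (INR (S k)) * (exp_term u (S k) * exp_term v (n - k)%nat)).
        rewrite Cmult_assoc, <- exp_term_S; ring.
      * replace (S n - k)%nat with (S (n - k)) by lia.
        change (v * (exp_term u k * exp_term v (n - k)%nat) =
          RtoC (INR (S (n - k))) * (exp_term u k * exp_term v (S (n - k)))).
        transitivity (exp_term u k * (v * exp_term v (n - k)%nat)); [ring|].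
        rewrite <- exp_term_S; ring.
    + rewrite <- sum_n_plus; apply sum_n_ext_loc; intros k Hk.
      change (RtoC (INR k) * (exp_term u k * exp_term v (S n - k)%nat) +
        RtoC (INR (S n - k)) * (exp_term u k * exp_term v (S n - k)%nat) =
        RtoC (INR (S n)) * (exp_term u k * exp_term v (S n - k)%nat)).
      rewrite minus_INR by lia; rewrite RtoC_minus; ring.
Qed.

(** The moduli are the terms of the real exponential series at [Cmod z]. *)
Lemma ex_series_Cmod_exp_term (z : C) : ex_series (fun n => Cmod (exp_term z n)).
Proof.
  exists (exp (Cmod z)).
  eapply is_series_ext; [|exact (proj1 (is_pseries_R _ _ _) (is_exp_Reals _))].
  intros n; unfold exp_term; cbv beta.
  rewrite Cmod_div by apply RtoC_INR_fact_neq_0.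
  rewrite Cmod_pow, Cmod_R, Rabs_pos_eq by apply pos_INR.
  apply Rmult_comm.
Qed.

Lemma is_series_R_0 : is_series (fun _ => 0%R) 0%R.
Proof.
  apply filterlim_ext with (fun _ => 0%R).
  - intros n; rewrite sum_n_const; symmetry; apply Rmult_0_r.
  - apply filterlim_const.
Qed.

Lemma is_series_exp_term_R (x : R) :
  is_series (V := C_R_NormedModule) (exp_term (RtoC x)) (RtoC (exp x)).
Proof.
  assert (E : forall n, exp_term (RtoC x) n = RtoC (/ INR (fact n) * x ^ n)).
  { intros n; unfold exp_term; rewrite <- RtoC_pow, <- RtoC_div by apply INR_fact_neq_0.
    f_equal; apply Rmult_comm. }
  apply is_series_C_components; split.
  - eapply is_series_ext; [|exact (proj1 (is_pseries_R _ _ _) (is_exp_Reals _))].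
    intros n; rewrite E; reflexivity.
  - apply is_series_ext with (2 := is_series_R_0).
    intros n; rewrite E; reflexivity.
Qed.

Lemma Ci_pow_even (m : nat) : Cpow Ci (2 * m) = RtoC ((-1) ^ m).
Proof.
  rewrite Cpow_mult_r, RtoC_pow; f_equal.
  unfold Ci; simpl; unfold Cmult, RtoC; simpl; f_equal; ring.
Qed.

(** Even powers of [Ci] are real and odd ones imaginary. Hence the real part is the cosine series in
    [y ^ 2], and the imaginary part is [y] times the series [sin_n] in [y ^ 2]. *)
Lemma is_series_exp_term_imaginary (y : R) :
  is_series (V := C_R_NormedModule) (exp_term (Ci * RtoC y)) (cos y, sin y).
Proof.
  assert (E : forall n, exp_term (Ci * RtoC y) n =
     RtoC (/ INR (fact n) * y ^ n) * Cpow Ci n).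
  { intros n; unfold exp_term; rewrite Cpow_mult_l, <- RtoC_pow.
    rewrite RtoC_mult, RtoC_inv by apply INR_fact_neq_0; field; apply RtoC_INR_fact_neq_0. }
  assert (Z : is_pseries (fun _ => 0%R) (y ^ 2)%R 0%R).
  { apply is_pseries_R; apply is_series_ext with (2 := is_series_R_0).
    intros n; symmetry; apply Rmult_0_l. }
  assert (Hodd : forall m, Cpow Ci (2 * m + 1) = Ci * RtoC ((-1) ^ m)).
  { intros m; rewrite Cpow_add_r, Cpow_1_r, Ci_pow_even; apply Cmult_comm. }
  apply is_series_C_components; split.
  - change (is_series (fun n => Re (exp_term (Ci * RtoC y) n)) (cos y)).
    apply is_series_ext with
      (fun n => (Re (Cpow Ci n) / INR (fact n) * y ^ n)%R).
    { intros n; rewrite E; destruct (Cpow Ci n); simpl; unfold Rdiv; ring. }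
    refine (proj1 (is_pseries_R (fun n => Re (Cpow Ci n) / INR (fact n))%R _ _) _).
    (* The 0 is the sum of the odd half, whose coefficients all vanish; for the sine below it is the
       even half that vanishes. *)
    replace (cos y) with (cos y + y * 0)%R by ring.
    apply (is_pseries_odd_even (fun n => (Re (Cpow Ci n) / INR (fact n))%R)).
    + apply is_pseries_ext with cos_n.
      { intros m; rewrite Ci_pow_even; reflexivity. }
      apply is_pseries_R; apply is_series_Reals.
      unfold cos; rewrite <- Rsqr_pow2.
      destruct (exist_cos (Rsqr y)) as [c Hc]; exact Hc.
    + apply is_pseries_ext with (2 := Z).
      intros m; rewrite Hodd; simpl; unfold Rdiv; ring.
  - change (is_series (fun n => Im (exp_term (Ci * RtoC y) n)) (sin y)).
    apply is_series_ext with
      (fun n => (Im (Cpow Ci n) / INR (fact n) * y ^ n)%R).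
    { intros n; rewrite E; destruct (Cpow Ci n); simpl; unfold Rdiv; ring. }
    refine (proj1 (is_pseries_R (fun n => Im (Cpow Ci n) / INR (fact n))%R _ _) _).
    assert (Hs : exists s, is_pseries sin_n (y ^ 2)%R s /\ sin y = (y * s)%R).
    { unfold sin; destruct (exist_sin (Rsqr y)) as [s Hs]; exists s; split;
        [|reflexivity].
      apply is_pseries_R; apply is_series_Reals; rewrite <- Rsqr_pow2; exact Hs. }
    destruct Hs as [s [Hs ->]].
    replace (y * s)%R with (0 + y * s)%R by ring.
    apply (is_pseries_odd_even (fun n => (Im (Cpow Ci n) / INR (fact n))%R)).
    + apply is_pseries_ext with (2 := Z).
      intros m; rewrite Ci_pow_even; simpl; unfold Rdiv; ring.
    + apply is_pseries_ext with (2 := Hs).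
      intros m; rewrite Hodd; unfold sin_n; simpl; unfold Rdiv; ring.
Qed.

(** [Cexp] is given by real [exp], [cos] and [sin], so its series is obtained as the Cauchy product
    of the series at [Re z] and at [Ci * Im z], whose terms [exp_term_plus] recombines. *)
Lemma is_series_Cexp (z : C) :
  is_series (V := C_R_NormedModule) (exp_term z) (Cexp z).
Proof.
  replace (Cexp z) with (RtoC (exp (Re z)) * (cos (Im z), sin (Im z)))
    by (unfold Cexp, Cmult, RtoC; simpl; f_equal; ring).
  apply is_series_ext with (fun n => sum_n (fun k =>
    exp_term (RtoC (Re z)) k * exp_term (Ci * RtoC (Im z)) (n - k)%nat) n).
  - intros n; rewrite <- exp_term_plus; f_equal.
    destruct z; unfold Cplus, Cmult, Ci, RtoC; simpl; f_equal; ring.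
  - apply is_series_C_mertens.
    + apply is_series_exp_term_R.
    + apply is_series_exp_term_imaginary.
    + apply ex_series_Cmod_exp_term.
Qed.

Lemma Cexp_plus (u v : C) : Cexp (u + v) = Cexp u * Cexp v.
Proof.
  unfold Cexp, Cmult, Re, Im; simpl; rewrite exp_plus, cos_plus, sin_plus.
  f_equal; ring.
Qed.

Lemma Cexp_RtoC (x : R) : Cexp (RtoC x) = RtoC (exp x).
Proof.
  unfold Cexp, RtoC; simpl; rewrite cos_0, sin_0; f_equal; ring.
Qed.

Lemma Cexp_opp_r (z : C) : Cexp z * Cexp (- z) = 1.
Proof.
  rewrite <- Cexp_plus; replace (z + - z) with (RtoC 0) by ring.
  rewrite Cexp_RtoC, exp_0; reflexivity.
Qed.

Lemma Rcpow_plus_INR (t : R) (s : C) (n : nat) :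
  (0 < t)%R -> Rcpow t (s + RtoC (INR n)) = RtoC (t ^ n) * Rcpow t s.
Proof.
  intros Ht; unfold Rcpow; rewrite Cmult_plus_distr_r, Cexp_plus.
  rewrite <- RtoC_mult, Cexp_RtoC.
  change (exp (INR n * ln t)) with (Rpower t (INR n)).
  rewrite Rpower_pow by exact Ht; apply Cmult_comm.
Qed.

(** * Improper integrals over ]0,1[ and the reflection of [t] to [1 - t] *)

(** Powers [Rcpow t s] behave well for [t > 0] only, so integrands are compared strictly inside the
    interval. Neighbourhoods of radius 1 already keep both integration bounds in ]0,1[. *)
Lemma is_RInt_gen_ext_01 {V : NormedModule R_AbsRing} (f g : R -> V) (l : V) :
  (forall t : R, (0 < t < 1)%R -> f t = g t) ->
  is_RInt_gen f (at_right 0) (at_left 1) l ->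
  is_RInt_gen g (at_right 0) (at_left 1) l.
Proof.
  intros Hfg; apply is_RInt_gen_ext.
  apply Filter_prod with (fun a => 0 < a < 1)%R (fun b => 0 < b < 1)%R.
  - exists (mkposreal 1 Rlt_0_1); intros u Hu H0.
    unfold ball in Hu; simpl in Hu; unfold AbsRing_ball, abs, minus, plus, opp in Hu;
      simpl in Hu; apply Rabs_def2 in Hu; lra.
  - exists (mkposreal 1 Rlt_0_1); intros u Hu H0.
    unfold ball in Hu; simpl in Hu; unfold AbsRing_ball, abs, minus, plus, opp in Hu;
      simpl in Hu; apply Rabs_def2 in Hu; lra.
  - intros a b Ha Hb t [H1 H2]; simpl in H1, H2; apply Hfg; split.
    + eapply Rlt_trans; [|exact H1]; apply Rmin_glb_lt; lra.
    + eapply Rlt_trans; [exact H2|]; apply Rmax_lub_lt; lra.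
Qed.

Lemma at_left_1_reflect (P : R -> Prop) :
  at_left 1 P -> at_right 0 (fun t => P (1 - t)%R).
Proof.
  intros [eps H]; exists eps; intros t Ht Ht0; apply H; [|lra].
  unfold ball in *; simpl in *; unfold AbsRing_ball, abs, minus, plus, opp in *;
    simpl in *; replace (1 - t + - (1))%R with (- (t + - 0))%R by ring.
  rewrite Rabs_Ropp; exact Ht.
Qed.

Lemma at_right_0_reflect (P : R -> Prop) :
  at_right 0 P -> at_left 1 (fun t => P (1 - t)%R).
Proof.
  intros [eps H]; exists eps; intros t Ht Ht0; apply H; [|lra].
  unfold ball in *; simpl in *; unfold AbsRing_ball, abs, minus, plus, opp in *;
    simpl in *; replace (1 - t + - 0)%R with (- (t + - (1)))%R by ring.
  rewrite Rabs_Ropp; exact Ht.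
Qed.

(** Linear substitution with slope -1; its sign is absorbed by exchanging the bounds. *)
Lemma is_RInt_reflect {V : NormedModule R_AbsRing} (f : R -> V) (a b : R) (l : V) :
  is_RInt f (1 - b) (1 - a) l -> is_RInt (fun t => f (1 - t)%R) a b l.
Proof.
  intros H; apply is_RInt_swap in H.
  rewrite <- (opp_opp l).
  apply is_RInt_ext with (fun t => opp (scal (-1)%R (f (-1 * t + 1)%R))).
  - intros t _.
    replace (scal (-1)%R (f (-1 * t + 1)%R)) with (opp (f (-1 * t + 1)%R))
      by (symmetry; apply (scal_opp_one (f (-1 * t + 1)%R))).
    rewrite opp_opp; f_equal; ring.
  - apply is_RInt_opp, is_RInt_comp_lin.
    replace (-1 * a + 1)%R with (1 - a)%R by ring.
    replace (-1 * b + 1)%R with (1 - b)%R by ring.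
    exact H.
Qed.

(** Reflection exchanges the filters at the two endpoints, so the witnessing neighbourhoods trade
    places. *)
Lemma is_RInt_gen_reflect_01 {V : NormedModule R_AbsRing} (f : R -> V) (l : V) :
  is_RInt_gen f (at_right 0) (at_left 1) l ->
  is_RInt_gen (fun t => f (1 - t)%R) (at_right 0) (at_left 1) l.
Proof.
  intros H P HP; destruct (H P HP) as [Q R HQ HR HQR].
  exists (fun a => R (1 - a)%R) (fun b => Q (1 - b)%R).
  - apply at_left_1_reflect, HR.
  - apply at_right_0_reflect, HQ.
  - intros a b Ha Hb; destruct (HQR _ _ Hb Ha) as [y [Hy HPy]].
    exists y; split; [apply is_RInt_reflect, Hy|exact HPy].
Qed.

(* The equality also covers divergent integrals: both sides are then the same
   description operator applied to extensionally equal predicates. *)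
Lemma CInt01_reflect (f : R -> C) : CInt01 (fun t => f (1 - t)%R) = CInt01 f.
Proof.
  unfold CInt01, RInt_gen; f_equal.
  apply functional_extensionality; intros l; apply propositional_extensionality.
  split; intros H; apply is_RInt_gen_reflect_01 in H; [|exact H].
  apply is_RInt_gen_ext_01 with (2 := H).
  intros t _; f_equal; ring.
Qed.

Lemma Beta_sym (x y : C) : Beta x y = Beta y x.
Proof.
  unfold Beta; rewrite <- CInt01_reflect; f_equal.
  apply functional_extensionality; intros t.
  replace (1 - (1 - t))%R with t by ring; apply Cmult_comm.
Qed.

(** * Termwise integration of a binomial expansion *)

Lemma is_RInt_gen_sum_n {V : NormedModule R_AbsRing} (Fa Fb : (R -> Prop) -> Prop)
    {FFa : Filter Fa} {FFb : Filter Fb} (f : nat -> R -> V) (l : nat -> V) (n : nat) :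
  (forall k, is_RInt_gen (f k) Fa Fb (l k)) ->
  is_RInt_gen (fun t => sum_n (fun k => f k t) n) Fa Fb (sum_n l n).
Proof.
  intros H; induction n as [|n IH].
  - rewrite sum_O.
    replace (fun t => sum_n (fun k => f k t) 0) with (f 0%nat); [apply H|].
    apply functional_extensionality; intros t; rewrite sum_O; reflexivity.
  - rewrite sum_Sn.
    replace (fun t => sum_n (fun k => f k t) (S n))
      with (fun t => plus (sum_n (fun k => f k t) n) (f (S n) t)).
    + apply is_RInt_gen_plus; [exact IH|apply H].
    + apply functional_extensionality; intros t; rewrite sum_Sn; reflexivity.
Qed.

(** The [a k] are the moments of [g]. The binomial expansion of [(1 - t) ^ n] is a finite sum, so
    linearity of the integral is enough. *)
Lemma is_RInt_gen_one_minus_pow {V : NormedModule R_AbsRing} (g : R -> V)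
    (a : nat -> V) (n : nat) :
  (forall k, is_RInt_gen (fun t => scal (t ^ k)%R (g t)) (at_right 0) (at_left 1) (a k)) ->
  is_RInt_gen (fun t => scal ((1 - t) ^ n)%R (g t)) (at_right 0) (at_left 1)
    (sum_n (fun k => scal (Binomial.C n k * (-1) ^ k)%R (a k)) n).
Proof.
  intros H.
  apply is_RInt_gen_ext_01 with (fun t => sum_n (fun k =>
    scal (Binomial.C n k * (-1) ^ k)%R (scal (t ^ k)%R (g t))) n).
  - intros t _.
    rewrite (sum_n_ext _ (fun k => scal (Binomial.C n k * (-1) ^ k * t ^ k)%R (g t)))
      by (intros k; rewrite scal_assoc; reflexivity).
    rewrite sum_n_scal_r; f_equal.
    replace (1 - t)%R with (- t + 1)%R by ring.
    rewrite binomial, sum_n_Reals; apply sum_eq; intros k _.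
    rewrite pow1.
    replace (- t)%R with (-1 * t)%R by ring.
    rewrite Rpow_mult_distr; ring.
  - apply (is_RInt_gen_sum_n _ _ (fun k t => scal (Binomial.C n k * (-1) ^ k)%R (scal (t ^ k)%R (g t)))).
    intros k; apply (is_RInt_gen_scal (fun t => scal (t ^ k)%R (g t))), H.
Qed.

(** * M-beta integrals and the transformation of the M-confluent series *)

(** The factorial of [n] cancels, and the sign turns the factor [(- z) ^ k] of [(- z) ^ n] into
    [z ^ k]. This is what makes a binomial transform a Cauchy product. *)
Lemma binomial_exp_term_opp (z : C) (n k : nat) :
  (k <= n)%nat ->
  RtoC (Binomial.C n k * (-1) ^ k)%R * exp_term (- z) n =
  exp_term z k * exp_term (- z) (n - k)%nat.
Proof.
  intros Hk.
  assert (Hz : Cpow z k = RtoC ((-1) ^ k)%R * Cpow (- z) k).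
  { rewrite RtoC_pow, <- Cpow_mult_l; f_equal; ring. }
  unfold exp_term; rewrite Hz.
  replace (Cpow (- z) n) with (Cpow (- z) k * Cpow (- z) (n - k)%nat)
    by (rewrite <- Cpow_add_r; f_equal; lia).
  unfold Binomial.C; rewrite RtoC_mult, RtoC_div, RtoC_mult.
  - field; repeat split; apply RtoC_INR_fact_neq_0.
  - apply Rmult_integral_contrapositive_currified; apply INR_fact_neq_0.
Qed.

Lemma scal_C_R (r : R) (w : C) :
  scal (V := C_R_NormedModule) r w = RtoC r * w.
Proof.
  destruct w; unfold scal, Cmult, RtoC; simpl; unfold prod_scal, scal; simpl;
    unfold mult; simpl; f_equal; ring.
Qed.

Lemma Mbeta_integrand_plus_INR (kappa mu : list C) (alpha beta x y rho : C)
    (k : nat) (t : R) :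
  (0 < t)%R ->
  Mbeta_integrand kappa mu alpha beta (x + RtoC (INR k)) y rho t =
  scal (V := C_R_NormedModule) (t ^ k)%R
    (Mbeta_integrand kappa mu alpha beta x y rho t).
Proof.
  intros Ht; rewrite scal_C_R; unfold Mbeta_integrand.
  replace (x + RtoC (INR k) - 1) with (x - 1 + RtoC (INR k)) by ring.
  rewrite Rcpow_plus_INR by exact Ht; ring.
Qed.

Lemma Mbeta_integrand_sym (kappa mu : list C) (alpha beta x y rho : C) (t : R) :
  Mbeta_integrand kappa mu alpha beta x y rho (1 - t) =
  Mbeta_integrand kappa mu alpha beta y x rho t.
Proof.
  unfold Mbeta_integrand, Mbeta_arg.
  replace (1 - (1 - t))%R with t by ring.
  rewrite (Rmult_comm (1 - t) t); ring.
Qed.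

(** Raising [x] by [k] multiplies the integrand by [t ^ k], so the hypothesis supplies all moments;
    expand [(1 - t) ^ n], then reflect. The form with [is_RInt_gen] gives convergence along with the
    value, and the theorem needs both. *)
Lemma is_RInt_gen_Mbeta_swap (kappa mu : list C) (alpha beta x y rho : C)
    (n : nat) :
  (forall k, Cex_int01
     (Mbeta_integrand kappa mu alpha beta (x + RtoC (INR k)) y rho)) ->
  is_RInt_gen (V := C_R_NormedModule)
    (Mbeta_integrand kappa mu alpha beta (y + RtoC (INR n)) x rho)
    (at_right 0) (at_left 1)
    (sum_n (fun k => scal (V := C_R_NormedModule)
       (Binomial.C n k * (-1) ^ k)%R
       (Mbeta kappa mu alpha beta (x + RtoC (INR k)) y rho)) n).
Proof.
  intros Hex.
  assert (Ha : forall k, is_RInt_gen (V := C_R_NormedModule)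
    (fun t => scal (V := C_R_NormedModule) (t ^ k)%R
       (Mbeta_integrand kappa mu alpha beta x y rho t))
    (at_right 0) (at_left 1)
    (Mbeta kappa mu alpha beta (x + RtoC (INR k)) y rho)).
  { intros k.
    apply is_RInt_gen_ext_01 with
      (Mbeta_integrand kappa mu alpha beta (x + RtoC (INR k)) y rho).
    - intros t [Ht _]; apply Mbeta_integrand_plus_INR, Ht.
    - apply (RInt_gen_correct (V := C_R_CompleteNormedModule)), Hex. }
  pose proof (is_RInt_gen_reflect_01 _ _
    (is_RInt_gen_one_minus_pow _ _ n Ha)) as H.
  apply is_RInt_gen_ext_01 with (2 := H).
  intros t [Ht _]; rewrite Mbeta_integrand_plus_INR by exact Ht.
  rewrite Mbeta_integrand_sym; f_equal; f_equal; ring.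
Qed.

Lemma Mbeta_swap (kappa mu : list C) (alpha beta x y rho : C) (n : nat) :
  (forall k, Cex_int01
     (Mbeta_integrand kappa mu alpha beta (x + RtoC (INR k)) y rho)) ->
  Mbeta kappa mu alpha beta (y + RtoC (INR n)) x rho =
  sum_n (fun k => scal (V := C_R_NormedModule) (Binomial.C n k * (-1) ^ k)%R
    (Mbeta kappa mu alpha beta (x + RtoC (INR k)) y rho)) n.
Proof.
  intros Hex; pose proof (is_RInt_gen_Mbeta_swap _ _ _ _ _ _ _ n Hex) as H.
  exact (is_RInt_gen_unique (V := C_R_CompleteNormedModule)
    (Mbeta_integrand kappa mu alpha beta (y + RtoC (INR n)) x rho) _ H).
Qed.

(** Symmetry of [Beta] gives both sides the same divisor [c]; then [binomial_exp_term_opp] is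
    applied to each summand of [Mbeta_swap]. *)
Lemma MPhi_term_swap (kappa mu : list C) (alpha beta l2 l3 z rho : C) (n : nat) :
  (forall k, Cex_int01
     (Mbeta_integrand kappa mu alpha beta (l2 + RtoC (INR k)) (l3 - l2) rho)) ->
  MPhi_term kappa mu alpha beta (l3 - l2) l3 (- z) rho n =
  sum_n (fun k => MPhi_term kappa mu alpha beta l2 l3 z rho k *
                  exp_term (- z) (n - k)%nat) n.
Proof.
  intros Hex; unfold MPhi_term.
  replace (l3 - (l3 - l2)) with l2 by ring.
  rewrite (Beta_sym (l3 - l2) l2).
  set (c := Beta l2 (l3 - l2)).
  rewrite (Mbeta_swap _ _ _ _ _ _ _ n Hex).
  unfold Cdiv at 1; rewrite <- Cmult_assoc.
  etransitivity; [symmetry; apply (sum_n_mult_r (K := C_Ring))|].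
  apply sum_n_ext_loc; intros k Hk; rewrite scal_C_R.
  set (m := Mbeta kappa mu alpha beta (l2 + RtoC (INR k)) (l3 - l2) rho).
  change (RtoC (Binomial.C n k * (-1) ^ k)%R * m * (/ c * exp_term (- z) n) =
    m / c * exp_term z k * exp_term (- z) (n - k)%nat).
  transitivity (m * / c *
    (RtoC (Binomial.C n k * (-1) ^ k)%R * exp_term (- z) n)); [ring|].
  rewrite binomial_exp_term_opp by exact Hk; unfold Cdiv; ring.
Qed.

Theorem theorem4p12 (p q : nat) (kappa mu : list C)
    (alpha beta l2 l3 rho z : C)
    (Hp : length kappa = p) (Hq : length mu = q)
    (Hkappa : forall k : C, In k kappa -> ~ nonpos_integer k)
    (Hmu : forall m : C, In m mu -> ~ nonpos_integer m)
    (Halpha : (0 < Re alpha)%R)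
    (Hl2 : (0 < Re l2)%R) (Hl3 : (Re l2 < Re l3)%R)
    (Hrho : (0 < Re rho)%R)
    (Hdef : MPhi_defined kappa mu alpha beta l2 l3 z rho) :
  MPhi_defined kappa mu alpha beta (l3 - l2) l3 (- z) rho /\
  MPhi kappa mu alpha beta l2 l3 z rho =
    Cexp z * MPhi kappa mu alpha beta (l3 - l2) l3 (- z) rho.
Proof.
  destruct Hdef as [Hbeta [s Hs]]; change C in s.
  assert (Hex : forall k, Cex_int01
    (Mbeta_integrand kappa mu alpha beta (l2 + RtoC (INR k)) (l3 - l2) rho))
    by (intros k; apply Hbeta).
  assert (H : is_series (V := C_R_NormedModule)
    (MPhi_term kappa mu alpha beta (l3 - l2) l3 (- z) rho) (s * Cexp (- z))).
  { eapply is_series_ext; [intros n; symmetry; apply MPhi_term_swap, Hex|].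
    apply is_series_C_mertens;
      [exact Hs|apply is_series_Cexp|apply ex_series_Cmod_exp_term]. }
  split; [split|].
  (* Convergence of the M-series at each [t] does not involve the exponents of the integrand, so the
     instance of the hypothesis at index 0 gives it for every [n]. *)
  - intros n; split; [apply (Hbeta 0%nat)|].
    replace (l3 - (l3 - l2)) with l2 by ring.
    eexists; apply is_RInt_gen_Mbeta_swap, Hex.
  - exists (s * Cexp (- z)); exact H.
  - unfold MPhi; rewrite (CSeries_unique _ _ Hs), (CSeries_unique _ _ H).
    (* The transformed series has sum [s * Cexp (- z)]; the prefactor [Cexp z] cancels the
       exponential. *)
    transitivity (s * (Cexp z * Cexp (- z))); [|ring].
    rewrite Cexp_opp_r; ring.
Qed.
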